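(* There exists a dense set of ordinate values $y$ in $[0,\frac23]$, all of which are dyadic rationals, such that for each such $y$ the level set $L(y)$ of the Takagi function contains an infinite number of distinct local level sets.
   Context: The Takagi function is $\tau(x)=\sum_{n=0}^\infty 2^{-n}\operatorname{dist}(2^n x,\mathbb{Z})$ for $x\in[0,1]$, where $\operatorname{dist}(t,\mathbb{Z})=\inf_{m\in\mathbb{Z}}|t-m|$; its values lie in $[0,\frac23]$. Convention: in level sets and local level sets, an element $x$ specifies a binary expansion $x=0.b_1b_2b_3\ldots=\sum_{j\ge1} b_j2^{-j}$ with $b_j\in\{0,1\}$; a dyadic rational in $(0,1)$ occurs twice, labelled by its two binary expansions (treated as distinct elements). For $0\le y\le \frac23$, the level set is $L(y)=\{x\in[0,1]:\tau(x)=y\}$ (where each element $x$ specifies a binary expansion, so that a dyadic rational in $(0,1)$ with $\tau(x)=y$ occurs twice, as two distinct elements labelled by its two binary expansions). For a binary expansion $x=0.b_1b_2\ldots$ put $D_0(x)=0$ and $D_j(x)=j-2(b_1+\cdots+b_j)$ for $j\ge1$. The balance-set is $Z(x)=\{j\ge 0: D_j(x)=0\}=\{c_0<c_1<c_2<\cdots\}$ with $c_0=0$; if $Z(x)$ is finite with last element $c_n$, set $c_{n+1}=+\infty$. The $k$-th block $B_k(x)$ is the indexed string of digits $(b_j)_{c_k<j\le c_{k+1}}$ (all $j>c_k$ if $c_{k+1}=+\infty$). Two expansions are equivalent, $x\sim x'$, if $Z(x)=Z(x')$ and for each $k$ the block $B_k(x')$ either equals $B_k(x)$ or is obtained from it by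 flipping every digit ($b_j\mapsto 1-b_j$ for all $j$ in the block). The local level set of $x$ is $L_x^{loc}=\{x': x'\sim x\}$. Each level set is a disjoint union of local level sets. *)

(* Defs.v *)
From mathcomp Require Import all_boot all_order all_algebra.
From mathcomp Require Import all_classical all_reals all_analysis.

Set Implicit Arguments.
Unset Strict Implicit.
Unset Printing Implicit Defensive.

Import Order.TTheory GRing.Theory Num.Theory.
Import numFieldNormedType.Exports.

Local Open Scope classical_set_scope.
Local Open Scope ring_scope.

Definition distZ (R : realType) (t : R) : R :=
  inf [set `|t - m%:~R| | m in [set: int]].

Definition takagi (R : realType) (x : R) : R :=
  limn (series (fun n : nat => distZ (2 ^+ n * x) / 2 ^+ n)).

(* Digits are indexed from 0: [b j] is the digit b_(j+1) of weight 2^-(j+1).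
   Every digit sequence counts as an element, so a dyadic rational of (0, 1)
   occurs twice, whereas 0 = 0.000... and 1 = 0.111... occur once. *)
Definition expansion := nat -> bool.

Definition expansion_val (R : realType) (b : expansion) : R :=
  limn (series (fun j : nat => (b j)%:R / 2 ^+ j.+1 : R)).

(* Values of expansions lie in [0, 1], so that constraint is implicit. *)
Definition takagi_level_set (R : realType) (y : R) : set expansion :=
  [set b | takagi (expansion_val R b) = y].

Definition deficit (b : expansion) (j : nat) : int :=
  j%:Z - 2 * (\sum_(i < j) b i)%N%:Z.

Definition balance_set (b : expansion) : set nat :=
  [set j | deficit b j = 0].

(* [m] is c_k: the element of the balance-set with exactly k smaller ones.
   No such [m] exists when c_k is infinite or undefined. *)
Definition balance_point (b : expansion) (k m : nat) : Prop :=
  balance_set b m /\ count (fun i => deficit b i == 0) (iota 0 m) = k.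

(* The positions i of the digits [b i] in the k-th block. As [b i] is the digit
   b_(i+1), the condition c_k < i + 1 <= c_(k+1) reads c_k <= i < c_(k+1). *)
Definition block_support (b : expansion) (k : nat) : set nat :=
  [set i | (exists2 m, balance_point b k m & (m <= i)%N) /\
           (forall n, balance_point b k.+1 n -> (i < n)%N)].

(* Once the balance-sets agree, [b] and [b'] have the same block supports. *)
Definition expansion_equiv (b b' : expansion) : Prop :=
  balance_set b = balance_set b' /\
  forall k, (forall i, block_support b k i -> b' i = b i) \/
            (forall i, block_support b k i -> b' i = ~~ b i).

Definition local_level_set (b : expansion) : set expansion :=
  [set b' | expansion_equiv b' b].

Definition dyadic (R : realType) (y : R) : Prop :=
  exists (m : int) (n : nat), y = m%:~R / 2 ^+ n.

Definition local_level_sets_of (R : realType) (y : R) : set (set expansion) :=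
  [set S | (exists b, S = local_level_set b) /\ S `<=` takagi_level_set y].

(* Main.v *)
Require Import Defs.
From mathcomp Require Import all_boot all_order all_algebra.
From mathcomp Require Import all_classical all_reals all_analysis.
From mathcomp Require Import zify ring lra.
Import Order.TTheory GRing.Theory Num.Theory.
Import numFieldNormedType.Exports.
Local Open Scope classical_set_scope.
Local Open Scope ring_scope.

(** Let s_j = 1 or -1 according as the digit b_j (counted from j = 0) is 0 or 1,
    and let D_j be the deficit before that digit. The functional equation
    tau(x) = dist(x, Z) + tau(2x)/2 says how tau changes when one digit is put
    in front of an expansion. It takes its simplest form for the tilted
    functions H_d(b) = tau(b) + d (b - 1/2): when a digit of sign s is put in
    front of b, the value of H_d there is H_(d+s)(b)/2 + (1 - s d)/4
    ([tilted_shift]).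
    Reading an expansion from d = 0, the tilt after j digits is therefore D_j,
    and tau(b) is the sum of the (1 - s_j D_j) / 2^(j+2) ([takagi_expand]).

    Three consequences carry the proof. Flipping a block changes the sign of
    both s_j and D_j for every j in it, so tau is constant on local level sets
    ([takagi_expansion_equiv]). Expansions that agree on their first n digits
    have values of tau within O(n / 2^n) ([takagi_close]). After a balanced word
    w of length n (one with as many 0 as 1) the tilt is 0 again, so the graph of
    tau above the interval coded by w is a copy, shrunk by 2^n, of the whole
    graph ([tilted_scat]).

    The level 1/2 contains infinitely many local level sets. Indeed prepending
    the word 01 sends the value h of H_1 to h/4 + 3/8, which fixes 1/2, and 1/2
    is the value of H_1 at 1000...; so tau = 1/2 at 0(01)^k 1000... for every k.
    The balance-set of this expansion is {0, 2k + 2}, which depends on k. In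
    front of all these expansions one may put a balanced word w; this gives
    infinitely many local level sets at a dyadic level y_w.

    The levels y_w are dense in [0, 2/3]. A digit-by-digit bisection finds an
    expansion b with tau(b) as close as desired to a given value of [0, 2/3];
    cutting b after n digits and appending the n opposite digits gives a
    balanced word w, and y_w is close to tau(b). *)

(** * Series with dyadic weights *)

Lemma cvg_dyadic_series {R : realType} {a : R^nat} (M : R) :
  (forall n, 0 <= a n <= M) -> cvgn (series (fun n => a n / 2 ^+ n)).
Proof.
move=> ha; apply: (@series_le_cvg _ _ (geometric M 2^-1)) => [n|n|n|].
- by have /andP[h _] := ha n; apply: divr_ge0 => //; apply: exprn_ge0.
- have /andP[h1 h2] := ha n.
  by rewrite /geometric /= mulr_ge0 ?exprn_ge0 ?invr_ge0 // (le_trans h1).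
- have /andP[_ h] := ha n.
  by rewrite /geometric /= exprVn ler_wpM2r // invr_ge0 exprn_ge0.
- by apply: is_cvg_geometric_series; rewrite ger0_norm ?invr_ge0 //; lra.
Qed.

Lemma dyadic_series_bounds {R : realType} {a : R^nat} {M : R} :
  (forall n, 0 <= a n <= M) ->
  0 <= limn (series (fun n => a n / 2 ^+ n)) <= 2 * M.
Proof.
move=> ha; have cvga := cvg_dyadic_series M ha.
have half_lt1 : `|2^-1 : R| < 1 by rewrite ger0_norm ?invr_ge0 //; lra.
apply/andP; split.
  apply: limr_ge => //; near=> n; rewrite /series /= sumr_ge0 // => i _.
  by have /andP[h _] := ha i; apply: divr_ge0 => //; apply: exprn_ge0.
have -> : 2 * M = limn (series (geometric M 2^-1)).
  rewrite (cvg_lim _ (cvg_geometric_series half_lt1)) //.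
  by field.
apply: lim_series_le => // [|n]; first exact: is_cvg_geometric_series.
have /andP[_ h] := ha n.
by rewrite /geometric /= exprVn ler_wpM2r // invr_ge0 exprn_ge0.
Unshelve. all: by end_near. Qed.

Lemma dyadic_series_shift {R : realType} {a : R^nat} {M : R} :
  (forall n, 0 <= a n <= M) ->
  limn (series (fun n => a n / 2 ^+ n)) =
  a 0%N + limn (series (fun n => a n.+1 / 2 ^+ n)) / 2.
Proof.
move=> ha; have cvgS := cvg_dyadic_series M (fun n => ha n.+1).
apply/cvg_lim => //; rewrite -cvg_shiftS.
rewrite (_ : (fun n => series _ n.+1) = (fun n =>
    a 0%N + series (fun n => a n.+1 / 2 ^+ n) n / 2)); last first.
  apply/funext => n; rewrite /series /= big_nat_recl // expr0 divr1.
  rewrite mulr_suml; congr (_ + _); apply: eq_bigr => i _.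
  by rewrite exprS invfM mulrCA mulrA [RHS]mulrC mulrA.
by apply: cvgD; [exact: cvg_cst | apply: cvgMl => //].
Qed.

(** * The functional equation of the Takagi function *)

Lemma distZ_le {R : realType} (t : R) (m : int) : distZ t <= `|t - m%:~R|.
Proof.
by apply: ge_inf; [exists 0 => _ [k _ <-] | exists m].
Qed.

Lemma le_distZ {R : realType} (t c : R) :
  (forall m : int, c <= `|t - m%:~R|) -> c <= distZ t.
Proof.
move=> h; apply: lb_le_inf; first by exists `|t - 0%:~R|, 0.
by move=> _ [m _ <-].
Qed.

Lemma distZ_bounds {R : realType} (t : R) : 0 <= distZ t <= 1.
Proof.
rewrite le_distZ //=; apply: le_trans (distZ_le t (Num.floor t)) _.
have := floor_itv t; rewrite intrD => /andP[h1 h2].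
by rewrite ler_norml; apply/andP; split; lra.
Qed.

Lemma distZ_addz {R : realType} (t : R) (k : int) : distZ (t + k%:~R) = distZ t.
Proof.
apply/eqP; rewrite eq_le; apply/andP; split; apply: le_distZ => m.
  apply: le_trans (distZ_le _ (m + k)) _; rewrite intrD.
  by rewrite (_ : _ - _ = t - m%:~R) //; ring.
apply: le_trans (distZ_le _ (m - k)) _; rewrite intrB.
by rewrite (_ : _ - _ = t + k%:~R - m%:~R) //; ring.
Qed.

(** The integers nearest to a point of the unit interval are 0 and 1. *)
Lemma le_distZ_unit {R : realType} (t c : R) : c <= t -> c <= 1 - t -> c <= distZ t.
Proof.
move=> ct c1t; apply: le_distZ => m; rewrite ler_normr; apply/orP.
case: (lerP m 0) => [|m0].
  by rewrite -(ler_int R) => hm; left; lra.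
have : 1 <= m by lia.
by rewrite -(ler_int R) => hm; right; lra.
Qed.

(** The first binary digit decides which of 0 and 1 is the nearest integer. *)
Lemma distZ_halves {R : realType} (v : R) (c : bool) : 0 <= v <= 1 ->
  distZ ((c%:R + v) / 2) = (if c then 1 - v else v) / 2.
Proof.
move=> /andP[v0 v1]; apply/eqP; rewrite eq_le; apply/andP; split.
  apply: le_trans (distZ_le _ (c : nat)) _; rewrite ler_norml.
  by case: c => /=; apply/andP; split; lra.
by apply: le_distZ_unit; case: c => /=; lra.
Qed.

Lemma takagi_bounds {R : realType} (x : R) : 0 <= takagi x <= 2.
Proof.
by rewrite -[2]mulr1; apply: dyadic_series_bounds => n; exact: distZ_bounds.
Qed.

Lemma takagi_doubling {R : realType} (x : R) :
  takagi x = distZ x + takagi (2 * x) / 2.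
Proof.
rewrite {1}/takagi (dyadic_series_shift (M := 1)); last first.
  by move=> n; exact: distZ_bounds.
rewrite expr0 mul1r; congr (_ + _ / 2).
rewrite /takagi; congr (limn (series _)); apply/funext => n.
by rewrite exprSr mulrA.
Qed.

Lemma takagi_addn {R : realType} (x : R) (k : nat) : takagi (k%:R + x) = takagi x.
Proof.
rewrite /takagi; congr (limn (series _)); apply/funext => n.
rewrite mulrDr -natrX -natrM addrC.
by rewrite -[((2 ^ n * k)%N)%:R]/(((2 ^ n * k)%N : int)%:~R) distZ_addz.
Qed.

(** * Dependence of the Takagi function on the digits *)

Definition shift (b : expansion) : expansion := fun i => b i.+1.

Definition scons (c : bool) (b : expansion) : expansion :=
  fun i => if i is j.+1 then b j else c.

Definition scat (w : seq bool) (b : expansion) : expansion := foldr scons b w.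

Lemma half_digit_bounds {R : realType} (c : bool) : 0 <= (c%:R / 2 : R) <= 1 / 2.
Proof. by case: c => /=; apply/andP; split; lra. Qed.

Lemma expansion_valE {R : realType} (b : expansion) :
  expansion_val R b = limn (series (fun n => (b n)%:R / 2 / 2 ^+ n : R)).
Proof.
rewrite /expansion_val; congr (limn (series _)).
by apply/funext => n; rewrite exprS invfM mulrA.
Qed.

Lemma expansion_val_bounds {R : realType} (b : expansion) :
  0 <= expansion_val R b <= 1.
Proof.
have hb n := @half_digit_bounds R (b n).
have := dyadic_series_bounds hb; rewrite mulrCA mul1r mulfV ?mulr1 ?pnatr_eq0 //.
by rewrite expansion_valE.
Qed.

Lemma expansion_val_shift {R : realType} (b : expansion) :
  expansion_val R b = ((b 0%N)%:R + expansion_val R (shift b)) / 2.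
Proof.
have hb n := @half_digit_bounds R (b n).
by rewrite !expansion_valE (dyadic_series_shift hb) mulrDl.
Qed.

Lemma takagi_shift {R : realType} (b : expansion) (v := expansion_val R (shift b)) :
  takagi (expansion_val R b) = ((if b 0%N then 1 - v else v) + takagi v) / 2.
Proof.
rewrite takagi_doubling expansion_val_shift distZ_halves ?expansion_val_bounds //.
by rewrite [2 * _]mulrC divfK ?pnatr_eq0 // takagi_addn mulrDl.
Qed.

(** The change of the deficit caused by a digit. *)
Definition step (c : bool) : int := if c then -1 else 1.

Lemma step_negb (c : bool) : step (~~ c) = - step c.
Proof. by case: c; rewrite /step ?opprK. Qed.

Lemma deficit0 (b : expansion) : deficit b 0 = 0.
Proof. by rewrite /deficit big_ord0. Qed.

Lemma deficitS (b : expansion) (j : nat) :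
  deficit b j.+1 = deficit b j + step (b j).
Proof. by rewrite /deficit big_ord_recr /=; case: (b j) => /=; lia. Qed.

Lemma deficit_shift (b : expansion) (j : nat) :
  deficit b j.+1 = step (b 0%N) + deficit (shift b) j.
Proof.
elim: j => [|j IH]; first by rewrite deficitS !deficit0 addr0 add0r.
by rewrite deficitS IH (deficitS (shift b) j) -addrA.
Qed.

Lemma deficit_scons (c : bool) (b : expansion) (j : nat) :
  deficit (scons c b) j.+1 = step c + deficit b j.
Proof. exact: deficit_shift. Qed.

Lemma deficit_le (b : expansion) (j : nat) : `|deficit b j| <= j%:Z.
Proof.
elim: j => [|j IH]; first by rewrite deficit0.
by rewrite deficitS; case: (b j) => /=; lia.
Qed.

(** If the value of w has n digits and deficit d, the graph of tau above the
    interval coded by w is that of t |-> tau(t) + d t, shrunk by 2^n and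
    translated. Centring the linear term at 1/2 instead makes the function
    invariant when d and all digits change sign together; this is why
    flipped blocks give equal terms in [tilted_shift]. *)
Definition tilted (R : realType) (d : int) (b : expansion) : R :=
  takagi (expansion_val R b) + d%:~R * (expansion_val R b - 1 / 2).

Lemma tilted0 {R : realType} (b : expansion) :
  tilted R 0 b = takagi (expansion_val R b).
Proof. by rewrite /tilted mul0r addr0. Qed.

Lemma tilted_shift {R : realType} (d : int) (b : expansion) :
  tilted R d b = tilted R (d + step (b 0%N)) (shift b) / 2
                 + (1 - (step (b 0%N) * d)%:~R) / 4.
Proof.
rewrite /tilted takagi_shift (expansion_val_shift b) intrD intrM.
by case: (b 0%N) => /=; rewrite /step; field.
Qed.

Lemma tilted_scons {R : realType} (d : int) (c : bool) (b : expansion) :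
  tilted R d (scons c b) = tilted R (d + step c) b / 2 + (1 - (step c * d)%:~R) / 4.
Proof. exact: tilted_shift. Qed.

Lemma norm_tilted_le {R : realType} (d : int) (b : expansion) :
  `|tilted R d b| <= 2 + `|d|%:~R.
Proof.
have /andP[t0 t2] := takagi_bounds (expansion_val R b).
have /andP[v0 v1] := @expansion_val_bounds R b.
rewrite intr_norm; apply: le_trans (ler_normD _ _) _.
apply: lerD; first by rewrite ger0_norm.
rewrite normrM ler_piMr // ler_norml; apply/andP; split; lra.
Qed.

Lemma iter_shiftE (b : expansion) (n : nat) : iter n shift b 0%N = b n.
Proof.
suff h i : iter n shift b i = b (n + i)%N by rewrite h addn0.
by elim: n i => //= n IH i; rewrite /shift IH addnS.
Qed.

(** Iterating [tilted_shift] from tilt 0: the tilt after n digits is the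
    deficit, and the digits enter only through the products of step and
    deficit. *)
Lemma takagi_expand {R : realType} (b : expansion) (n : nat) :
  tilted R 0 b =
    \sum_(j < n) (1 - (step (b j) * deficit b j)%:~R) / 2 ^+ (j + 2)
    + tilted R (deficit b n) (iter n shift b) / 2 ^+ n.
Proof.
elim: n => [|n IH]; first by rewrite big_ord0 deficit0 expr0 divr1 add0r.
rewrite IH big_ord_recr /= -addrA; congr (_ + _).
rewrite tilted_shift iter_shiftE deficitS (exprD 2 n 2) (exprSr 2 n).
have : (2 ^+ n : R) != 0 by rewrite expf_neq0.
by move: (2 ^+ n : R) => p p0; field.
Qed.

(** The remainder in [takagi_expand] grows linearly with the deficit, which is
    at most n, but is divided by 2^n. *)
Lemma takagi_close {R : realType} (b b' : expansion) (n : nat) :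
  (forall j, (j < n)%N -> step (b j) * deficit b j = step (b' j) * deficit b' j) ->
  `|tilted R 0 b - tilted R 0 b'| <= 2 * ((n%:R + 2) / 2 ^+ n).
Proof.
move=> h; rewrite (takagi_expand b n) (takagi_expand b' n).
rewrite (eq_bigr (fun j : 'I_n =>
    (1 - (step (b' j) * deficit b' j)%:~R) / 2 ^+ (j + 2) : R)); last first.
  by move=> j _; rewrite h.
have tail d : `|tilted R (deficit d n) (iter n shift d)| <= n%:R + 2.
  apply: le_trans (norm_tilted_le _ _) _.
  by rewrite addrC lerD2r; have := deficit_le d n; rewrite -(ler_int R).
rewrite (_ : _ - _ = (tilted R (deficit b n) (iter n shift b)
   - tilted R (deficit b' n) (iter n shift b')) / 2 ^+ n); last by ring.
rewrite normrM [X in _ * X]ger0_norm ?invr_ge0 ?exprn_ge0 // mulrA.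
rewrite ler_wpM2r ?invr_ge0 ?exprn_ge0 //.
apply: le_trans (ler_normB _ _) _.
by have := tail b; have := tail b'; lra.
Qed.

(** With n = 2m the quotient is 2 (m + 1) / 4^m, and m + 1 <= 2^m bounds it
    by 2 / 2^m. *)
Lemma exists_small {R : realType} (e : R) : 0 < e ->
  exists n : nat, (n%:R + 2) / 2 ^+ n < e.
Proof.
move=> e0; pose m := Num.bound (2 / e).
have hm : 2 / e < m%:R by apply: archi_boundP; apply: divr_ge0 => //; exact: ltW.
have le2m : m%:R + 1 <= 2 ^+ m :> R.
  by rewrite -natrX natr1 ler_nat ltn_expl.
exists (m + m)%N; rewrite exprD natrD.
rewrite ltr_pdivrMr in hm => //.
have m0 : 0 <= m%:R :> R by [].
move: (2 ^+ m : R) (m%:R : R) le2m hm m0 => p q pq qe q0.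
rewrite ltr_pdivrMr; last by apply: mulr_gt0; lra.
apply: (@le_lt_trans _ _ (2 * p)); first by lra.
have p0 : 0 < p by lra.
rewrite mulrA ltr_pM2r //; apply: lt_le_trans qe _.
by rewrite mulrC ler_wpM2l ?(ltW e0) //; lra.
Qed.

(** * Constancy on local level sets *)

(** A position i lies in block k exactly when k + 1 elements of the balance-set
    are at most i; this count replaces the search for the ends of a block. *)
Definition zero_count (b : expansion) (j : nat) : nat :=
  count (fun i => deficit b i == 0) (iota 0 j).

Lemma zero_countS b j :
  zero_count b j.+1 = (zero_count b j + (deficit b j == 0))%N.
Proof. by rewrite /zero_count -addn1 iotaD count_cat /= addn0. Qed.

Lemma zero_count_le b i j : (i <= j)%N -> (zero_count b i <= zero_count b j)%N.
Proof.
by move=> ij; rewrite -(subnKC ij) /zero_count iotaD count_cat leq_addr.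
Qed.

Lemma block_supportI b k i : zero_count b i.+1 = k.+1 -> block_support b k i.
Proof.
move=> hk; split.
  elim: i hk => [|i IH]; rewrite zero_countS.
    rewrite /zero_count /= deficit0 => -[<-]; exists 0%N => //.
    by split; rewrite /balance_set /= ?deficit0.
  case: eqP => [h0|_]; last by rewrite addn0 => /IH[m hm mi]; exists m => //; apply: leqW.
  by rewrite addn1 => -[hk]; exists i.+1.
move=> n [n0 hn]; rewrite ltnNge; apply/negP => ni.
have : (zero_count b n.+1 <= zero_count b i.+1)%N by apply: zero_count_le.
rewrite hk zero_countS /zero_count hn (_ : (deficit b n == 0) = true) ?addn1 ?ltnn //.
by apply/eqP.
Qed.

(** In a flipped block both the digit signs and the deficits are reversed, as
    the deficit vanishes where the block starts. Hence the induction follows the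
    deficit inside a block and restarts at each element of the balance-set. *)
Lemma expansion_equiv_step b b' : expansion_equiv b b' ->
  forall j, step (b j) * deficit b j = step (b' j) * deficit b' j.
Proof.
move=> [Zbb' flips].
have zeroE j : deficit b j = 0 <-> deficit b' j = 0.
  by have : balance_set b j <-> balance_set b' j by rewrite Zbb'.
have count_pos j : zero_count b j.+1 = (zero_count b j.+1).-1.+1.
  apply/esym/prednK; apply: leq_trans (zero_count_le b 1 j.+1 _) => //.
  by rewrite /zero_count /= deficit0.
have deficitE j k : zero_count b j.+1 = k.+1 ->
    ((forall i, block_support b k i -> b' i = b i) -> deficit b' j = deficit b j) /\
    ((forall i, block_support b k i -> b' i = ~~ b i) -> deficit b' j = - deficit b j).
  elim: j k => [|j IH] k; first by rewrite !deficit0.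
  rewrite zero_countS; case: eqP => [h0 _|_].
    by rewrite h0 oppr0; have /zeroE -> := h0.
  rewrite addn0 => hk; have bk := block_supportI _ _ _ hk.
  have [same flip] := IH k hk; rewrite !deficitS; split=> h.
    by rewrite (same h) (h _ bk).
  by rewrite (flip h) (h _ bk) step_negb -opprD.
move=> j; have [same flip] := deficitE j _ (count_pos j).
have bk := block_supportI _ _ _ (count_pos j).
have [h|h] := flips (zero_count b j.+1).-1.
  by rewrite (same h) (h _ bk).
by rewrite (flip h) (h _ bk) step_negb mulrNN.
Qed.

Lemma takagi_expansion_equiv {R : realType} b b' : expansion_equiv b b' ->
  takagi (expansion_val R b) = takagi (expansion_val R b').
Proof.
move=> /expansion_equiv_step bb'; rewrite -!tilted0.
apply/eqP; rewrite -subr_eq0 -normr_le0; apply/ler_addgt0Pr => e e0.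
have [|n hn] := exists_small (e / 2); first by lra.
apply: le_trans (takagi_close _ _ n _) _ => [j _|]; first exact: bb'.
by rewrite add0r; lra.
Qed.

(** * Approximation of every value in [0, 2/3] *)

Lemma tilted_zeros {R : realType} (d : int) :
  tilted R d (fun=> false) = - d%:~R / 2.
Proof.
have v0 : expansion_val R (fun=> false) = 0.
  by have := @expansion_val_shift R (fun=> false); rewrite /shift /=; lra.
have := @takagi_shift R (fun=> false); rewrite /tilted /= /shift v0.
by lra.
Qed.

(** H_d runs from -d/2 at 000... to d/2 at 111..., and takes the value 1/2 at
    the middle point, 1000... or 0111...: hence the values at most 1/2 are
    sought in the first half and the others in the second. Each digit halves
    the distance to the target and raises the tilt by at most 1. *)
Lemma tilted_approx {R : realType} (n : nat) (d : int) (y : R) :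
  0 <= d -> `|y| <= d%:~R / 2 ->
  exists b, `|tilted R d b - y| <= (d%:~R + n%:R) / 2 ^+ n.
Proof.
elim: n d y => [|n IH] d y d0 hy.
  exists (fun=> false); rewrite tilted_zeros expr0 divr1 addr0.
  by move: hy; rewrite !ler_norml => /andP[]; lra.
have step_err c b : `|tilted R (d + step c) b - (2 * y - (1 - (step c * d)%:~R) / 2)|
    <= ((d + step c)%:~R + n%:R) / 2 ^+ n ->
  `|tilted R d (scons c b) - y| <= (d%:~R + n.+1%:R) / 2 ^+ n.+1.
  rewrite tilted_scons => h.
  rewrite (_ : _ - y = (tilted R (d + step c) b -
     (2 * y - (1 - (step c * d)%:~R) / 2)) / 2); last by field.
  rewrite normrM [X in _ * X]ger0_norm ?invr_ge0 //.
  rewrite exprSr invfM mulrA ler_wpM2r ?invr_ge0 //; apply: le_trans h _.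
  rewrite ler_wpM2r ?invr_ge0 ?exprn_ge0 // intrD -natr1.
  by case: c => /=; rewrite /step; lra.
have := hy; rewrite ler_norml => /andP[y1 y2].
have [yle|ygt] := lerP y (1 / 2).
  have [| |b hb] := IH (d + step false) (2 * y - (1 - (step false * d)%:~R) / 2).
  - by rewrite /step; lia.
  - by rewrite /step mul1r intrD ler_norml; apply/andP; split; lra.
  by exists (scons false b); exact: step_err.
have d1 : 1 <= d.
  have : 0 < d%:~R :> R by lra.
  by rewrite ltr0z; lia.
have [| |b hb] := IH (d + step true) (2 * y - (1 - (step true * d)%:~R) / 2).
- by rewrite /step; lia.
- by rewrite /step mulN1r intrD mulrNz ler_norml; apply/andP; split; lra.
by exists (scons true b); exact: step_err.
Qed.

(** The words 01 come back to the same tilt, which yields contractions. *)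
Lemma tilted_updown {R : realType} (d : int) (b : expansion) :
  tilted R d (scons false (scons true b)) = tilted R d b / 4 + (4 - d%:~R) / 8.
Proof.
rewrite !tilted_scons /step addrK mul1r mulN1r mulrNz intrD.
by field.
Qed.

(** The values in [0, 1/2] are reached after the digit 0, where the tilt is 1.
    The others are reached after 01, which maps [0, 2/3] onto [1/2, 2/3]. *)
Lemma takagi_approx {R : realType} (n : nat) (y : R) : 0 <= y <= 2 / 3 ->
  exists b, `|tilted R 0 b - y| <= (n%:R + 2) / 2 ^+ n.
Proof.
elim: n y => [|n IH] y /andP[y0 y1].
  exists (fun=> false); rewrite tilted_zeros expr0 ler_norml.
  by apply/andP; split; lra.
have [yle|ygt] := lerP y (1 / 2).
  have [| |b hb] := @tilted_approx R n.+1 1 (2 * y - 1 / 2) => //.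
    by rewrite ler_norml; apply/andP; split; lra.
  exists (scons false b); rewrite tilted_scons /step add0r mulr0 subr0.
  rewrite (_ : _ - y = (tilted R 1 b - (2 * y - 1 / 2)) / 2); last by field.
  rewrite normrM [X in _ * X]ger0_norm ?invr_ge0 // ler_pdivrMr //.
  apply: le_trans hb _; rewrite mulrAC ler_wpM2r ?invr_ge0 ?exprn_ge0 //.
  by have : 0 <= n.+1%:R :> R by []; lra.
have [|b hb] := IH (4 * y - 2); first by apply/andP; split; lra.
exists (scons false (scons true b)); rewrite tilted_updown.
rewrite (_ : _ - y = (tilted R 0 b - (4 * y - 2)) / 4); last by field.
rewrite normrM [X in _ * X]ger0_norm ?invr_ge0 // ler_pdivrMr //.
apply: le_trans hb _; rewrite exprS invfM -(natr1 n).
have : 0 <= (2 ^+ n)^-1 :> R by rewrite invr_ge0 exprn_ge0.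
have : 0 <= n%:R :> R by [].
by move: (n%:R : R) ((2 ^+ n)^-1 : R) => p q p0 q0; nra.
Qed.

(** Two digits change a bound u for tau into 1/2 + u/4, whose fixed point
    is 2/3. *)
Lemma takagi_le_two_thirds {R : realType} (b : expansion) : tilted R 0 b <= 2 / 3.
Proof.
have two_digits d : tilted R 0 d <= 1 / 2 + tilted R 0 (shift (shift d)) / 4.
  rewrite tilted_shift (tilted_shift _ (shift d)) /shift /=.
  have := @expansion_val_bounds R (fun i => d i.+2).
  rewrite /tilted; move: (expansion_val _ _) (takagi _) => v t /andP[v0 v1].
  by case: (d 0%N); case: (d 1%N); rewrite /step /=; lra.
have iterated n : forall d, tilted R 0 d <= 2 / 3 + 2 * (1 / 4 ^+ n).
  elim: n => [|n IH] d.
    have /andP[_] := takagi_bounds (expansion_val R d).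
    by rewrite tilted0 expr0; lra.
  apply: le_trans (two_digits d) _; have := IH (shift (shift d)).
  rewrite exprS; have p0 : (4 ^+ n : R) != 0 by rewrite expf_neq0.
  rewrite (_ : 1 / (4 * 4 ^+ n) = 1 / 4 ^+ n / 4 :> R); last by field.
  by lra.
apply/ler_addgt0Pr => e e0.
have [|n hn] := exists_small (e / 2); first by lra.
apply: le_trans (iterated n b) _; rewrite lerD2l.
suff : 1 / 4 ^+ n <= (n%:R + 2) / 2 ^+ n :> R by lra.
rewrite div1r; apply: (@le_trans _ _ (2 ^+ n)^-1); last first.
  rewrite ler_peMl ?invr_ge0 ?exprn_ge0 //.
  by have : 0 <= n%:R :> R by []; lra.
by rewrite lef_pV2 ?posrE ?exprn_gt0 // lerXn2r ?nnegrE //; lra.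
Qed.

(** * Balanced prefixes and the level 1/2 *)

(** The deficit of a finite word. *)
Definition weight (w : seq bool) : int := \sum_(c <- w) step c.

Lemma weight_cons c w : weight (c :: w) = step c + weight w.
Proof. by rewrite /weight big_cons. Qed.

(** Two expansions with a common prefix collect the same constants in
    [tilted_shift], so only the scaled difference of their tails remains. *)
Lemma tilted_scat {R : realType} (w : seq bool) (d : int) (b b' : expansion) :
  tilted R d (scat w b) - tilted R d (scat w b') =
  (tilted R (d + weight w) b - tilted R (d + weight w) b') / 2 ^+ size w.
Proof.
elim: w d => [|c w IH] d; first by rewrite /weight big_nil addr0 expr0 divr1.
rewrite /= !tilted_scons -!/(scat w _) opprD addrACA subrr addr0 -mulrBl IH.
by rewrite weight_cons addrA -mulrA -invfM -exprSr.
Qed.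

Lemma dyadic_tilted_scat {R : realType} (w : seq bool) (d : int) (b : expansion) :
  dyadic (tilted R (d + weight w) b) -> dyadic (tilted R d (scat w b)).
Proof.
elim: w d => [|c w IH] d; first by rewrite /weight big_nil addr0.
rewrite weight_cons addrA => /IH[m [n mn]].
exists (2 * m + (1 - step c * d) * 2 ^+ n), (n.+2).
have pE : (2 ^+ n)%:~R = 2 ^+ n :> R by rewrite rmorphXn.
rewrite tilted_scons -/(scat w b) mn !exprS !intrD !intrM pE intrB intrM.
rewrite (_ : 2%:~R = 2 :> R) // (_ : 1%:~R = 1 :> R) //.
have : (2 ^+ n : R) != 0 by rewrite expf_neq0.
by move: (2 ^+ n : R) => p p0; field.
Qed.

Lemma deficit_scat (w : seq bool) (b : expansion) (j : nat) :
  deficit (scat w b) (size w + j) = weight w + deficit b j.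
Proof.
elim: w => [|c w IH]; first by rewrite /weight big_nil add0r.
by rewrite addSn deficit_shift weight_cons -addrA -IH.
Qed.

(** The expansion 0(01)^k 1000... *)
Definition half_point (k : nat) : expansion :=
  scons false (iter k (fun b => scons false (scons true b))
                 (scons true (fun=> false))).

(** After the first 0 the tilt is 1, and 1/2 is the fixed point of the effect
    of the word 01 at tilt 1. *)
Lemma tilted_half_point {R : realType} (k : nat) : tilted R 0 (half_point k) = 1 / 2.
Proof.
rewrite tilted_scons /step add0r mulr0.
set t := iter _ _ _; suff -> : tilted R 1 t = 1 / 2 by field.
rewrite {}/t; elim: k => [|k IH] /=.
  by rewrite tilted_scons /step subrr tilted_zeros; field.
by rewrite tilted_updown IH; field.
Qed.

(** Position 2k + 2 is the last zero of the deficit: only digits 0 follow. *)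
Lemma deficit_half_point (k j : nat) : deficit (half_point k) (k.+1.*2 + j) = j%:Z.
Proof.
rewrite doubleS addSn deficit_scons /step.
suff -> : deficit (iter k (fun b => scons false (scons true b))
    (scons true (fun=> false))) (k.*2.+1 + j) = -1 + j%:Z by lia.
elim: k => [|k IH] /=.
  rewrite deficit_scons /step; congr (_ + _).
  by elim: j => [|j IH]; rewrite ?deficit0 // deficitS IH /= /step; lia.
by rewrite doubleS !addSn 2!deficit_scons /step addrA subrr add0r -addSn.
Qed.

(** A local level set determines the balance-set, whose last element here is
    2k + 2 more than the length of w. *)
Lemma local_level_set_half_point_inj (w : seq bool) : weight w = 0 ->
  injective (fun k => local_level_set (scat w (half_point k))).
Proof.
move=> w0 k l; wlog : k l / (k <= l)%N => [wlg kl|].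
  by case/orP: (leq_total k l) => h; [|apply/esym]; apply: wlg.
move=> kl eqS.
have [Zkl _] : local_level_set (scat w (half_point l)) (scat w (half_point k)).
  by rewrite -eqS; split=> // i; left.
have : balance_set (scat w (half_point l)) (size w + l.+1.*2)%N.
  rewrite /balance_set /= deficit_scat w0.
  by rewrite -[l.+1.*2]addn0 deficit_half_point.
rewrite -Zkl /balance_set /= deficit_scat w0 -(subnKC kl).
rewrite (_ : (k + (l - k)).+1.*2 = k.+1.*2 + (l - k).*2)%N; last by lia.
by rewrite deficit_half_point; lia.
Qed.

Lemma scat_mkseq (b b' : expansion) (w : seq bool) (n j : nat) :
  (j < n)%N -> scat (mkseq b n ++ w) b' j = b j.
Proof.
move=> jn; suff scatE v i : (i < size v)%N -> scat v b' i = nth false v i.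
  by rewrite scatE ?nth_cat ?size_cat size_mkseq ?jn ?nth_mkseq // ltn_addr.
by elim: v i => // c v IH [|i] //=; apply: IH.
Qed.

(** The word is made of the first n digits of b and their opposites. *)
Lemma balanced_approx {R : realType} (b : expansion) (n : nat) :
  exists2 w, weight w = 0 & forall b',
    `|tilted R 0 b - tilted R 0 (scat w b')| <= 2 * ((n%:R + 2) / 2 ^+ n).
Proof.
exists (mkseq b n ++ map negb (mkseq b n)).
  rewrite /weight big_cat big_map /= -big_split big1 // => c _.
  by case: c.
move=> b'; apply: takagi_close => j jn.
rewrite scat_mkseq //; congr (_ * _).
elim: j jn => [|j IH] jn; first by rewrite !deficit0.
by rewrite !deficitS IH ?(ltnW jn) // scat_mkseq // ltnW.
Qed.

Theorem theorem1p7 (R : realType) :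
  exists Y : set R,
    [/\ Y `<=` `[0, 2 / 3]%classic,
        `[0, 2 / 3]%classic `<=` closure Y,
        (forall y, Y y -> dyadic y) &
        (forall y, Y y -> infinite_set (local_level_sets_of y))].
Proof.
exists [set y | exists2 w, weight w = 0 & y = tilted R 0 (scat w (half_point 0))].
split.
- move=> _ [w _ ->]; rewrite /= in_itv /= takagi_le_two_thirds andbT tilted0.
  by have /andP[] := takagi_bounds (expansion_val R (scat w (half_point 0))).
- move=> y; rewrite /= in_itv /= => hy B /nbhs_ballP[e /= e0 eB].
  (* One third is for the approximation of y, two for the change of tail. *)
  have [|n hn] := exists_small (e / 3); first by lra.
  have [b hb] := takagi_approx n y hy.
  have [w w0 hw] := @balanced_approx R b n.
  exists (tilted R 0 (scat w (half_point 0))); split; first by exists w.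
  apply: eB; rewrite /ball /= -[X in X - _](subrK (tilted R 0 b)) -addrA.
  apply: le_lt_trans (ler_normD _ _) _; rewrite distrC.
  by have := hw (half_point 0); lra.
- move=> _ [w w0 ->]; apply: dyadic_tilted_scat.
  by rewrite w0 addr0 tilted_half_point; exists 1, 1%N.
move=> _ [w w0 ->]; apply: (sub_infinite_set (A := range (fun k =>
    local_level_set (scat w (half_point k))))).
  move=> _ [k _ <-]; split; first by exists (scat w (half_point k)).
  move=> b /takagi_expansion_equiv; rewrite /takagi_level_set /= => ->.
  rewrite -tilted0; apply/eqP; rewrite -subr_eq0 tilted_scat w0 addr0.
  by rewrite !tilted_half_point subrr mul0r.
apply/infiniteP; rewrite (card_le_eqr (inj_card_eq _)) ?card_lexx //.
by apply: in2W; exact: local_level_set_half_point_inj.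
Qed.
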